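(* There is a constant $k$, depending only on the fixed universal machine $U$, such that for every natural number $m$ there exists a compression function $q$ with $|q| \le m + k$ such that for every binary string $x$: (1) if $C(x) \le m$ then $|q(x)| = C(x)$; (2) if $C(x) > m$ then $|q(x)| \le |x| + k$.
   Context: All strings are over $\{0,1\}$. The pairing function is $\langle x,y\rangle := 1^{|x|}0xy$. $U$ is a fixed universal Turing machine such that for every Turing machine $M$ there is a string $p$ with $M(x) = U(\langle p,x\rangle)$ for every $x$ on which $M(x)$ is defined. For a string $p$ (a ''program'') we write $p(x) := U(\langle p,x\rangle)$. The Kolmogorov complexity $C(x)$ is the length of a shortest string $p$ with $U(p) = x$. A compression function for length $n$ is a program $q$ such that $q(z)$ is defined and $U(q(z)) = z$ for all strings $z$ of length $n$; a compression function is a program $q$ that is a compression function for length $n$ for every $n$. $|q|$ denotes the length of the program $q$.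
   Formalization: U is also assumed to hard-wire data cheaply: for each program p there is c such that every string d has a program q with |q| ≤ |d|+c and q(x)=p(⟨d,x⟩) whenever defined; without this the claim fails, e.g. for U(⟨1^i0,x⟩)=M_i(x), undefined elsewhere. *)

(* Defs.v *)
From mathcomp Require Import all_boot.
From Stdlib Require Import ClassicalEpsilon.
Set Implicit Arguments. Unset Strict Implicit. Unset Printing Implicit Defensive.

Definition bitstring := seq bool.

Definition pair_str (x y : bitstring) : bitstring :=
  nseq (size x) true ++ false :: x ++ y.

(* A tape cell holds a blank (None), a bit, or an auxiliary symbol from G. *)
Definition symbol (G : Type) := option (bool + G).

Inductive move := MoveLeft | Stay | MoveRight.

(* A two-way infinite tape: the cells left of the head (nearest first), the
   scanned cell, and the cells right of the head (nearest first); all cells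
   not listed are blank. *)
Record tape (G : Type) := Tape {
  cells_left : seq (symbol G);
  scanned : symbol G;
  cells_right : seq (symbol G)
}.

Definition tape_of (G : Type) (s : seq (symbol G)) : tape G :=
  Tape [::] (head None s) (behead s).

Definition write (G : Type) (a : symbol G) (t : tape G) : tape G :=
  Tape (cells_left t) a (cells_right t).

Definition shift (G : Type) (d : move) (t : tape G) : tape G :=
  let: Tape l a r := t in
  match d with
  | MoveLeft => Tape (behead l) (head None l) (a :: r)
  | Stay => t
  | MoveRight => Tape (a :: l) (head None r) (behead r)
  end.

(* Deterministic Turing machines with any positive number of tapes; tape 0
   carries the input and the output. *)
Record machine := Machine {
  work_tapes : nat;
  state : finType;
  aux : finType;
  start : state;
  halting : pred state;
  trans : state -> {ffun 'I_work_tapes.+1 -> symbol aux} ->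
          state * {ffun 'I_work_tapes.+1 -> symbol aux * move}
}.

Definition config (M : machine) : Type :=
  (state M * {ffun 'I_(work_tapes M).+1 -> tape (aux M)})%type.

Definition step (M : machine) (c : config M) : config M :=
  if halting c.1 then c else
  let a := trans c.1 [ffun i => scanned (c.2 i)] in
  (a.1, [ffun i => shift (a.2 i).2 (write (a.2 i).1 (c.2 i))]).

Definition init (M : machine) (x : bitstring) : config M :=
  (start M,
   [ffun i => tape_of (if i == ord0 then [seq Some (inl b) | b <- x] else [::])]).

Fixpoint leading_bits (G : Type) (s : seq (symbol G)) : bitstring :=
  if s is Some (inl b) :: s' then b :: leading_bits s' else [::].

(* The output is the longest block of bits on tape 0 that starts at the head
   and extends to the right. *)
Definition output (M : machine) (c : config M) : bitstring :=
  let t := c.2 ord0 in leading_bits (scanned t :: cells_right t).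

(* M(x) is defined and equal to y. Halted configurations are fixed by step, so
   there is at most one such y. *)
Definition computes (M : machine) (x y : bitstring) : Prop :=
  exists n, let c := iter n (@step M) (init M x) in
            halting c.1 /\ output c = y.

Definition universal (U : machine) : Prop :=
  forall M : machine, exists p : bitstring,
  forall x y, computes M x y -> computes U (pair_str p x) y.

(* Fixing the first component d of the input of a program costs |d| + O(1)
   bits. This is not a consequence of universal U: the machine that
   runs the i-th Turing machine on x when given the pair of 1^i 0 and x, and
   diverges on all other inputs, is universal but has only n programs of length
   at most n that are defined anywhere. *)
Definition hardwires_data (U : machine) : Prop :=
  forall p : bitstring, exists c : nat, forall d : bitstring,
  exists q : bitstring, size q <= size d + c /\
  forall x y, computes U (pair_str p (pair_str d x)) y ->
              computes U (pair_str q x) y.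

Definition is_shortest_length (U : machine) (x : bitstring) (c : nat) : Prop :=
  (exists p, computes U p x /\ size p = c) /\
  (forall p, computes U p x -> c <= size p).

(* The Kolmogorov complexity of x; see CP for its existence. *)
Definition C (U : machine) (x : bitstring) : nat :=
  epsilon (inhabits 0) (is_shortest_length U x).

Definition compression_function_for (U : machine) (q : bitstring) (n : nat) :=
  forall z : bitstring, size z = n ->
  exists y, computes U (pair_str q z) y /\ computes U y z.

Definition compression_function (U : machine) (q : bitstring) : Prop :=
  forall n, compression_function_for U q n.

Lemma computes_unique (M : machine) (x y z : bitstring) :
  computes M x y -> computes M x z -> y = z.
Proof.
have fixd (c : config M) k : halting c.1 -> iter k (@step M) c = c.
  by move=> h; elim: k => //= k ->; rewrite /step h.
case=> n [hn <-]; case=> k [hk <-].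
case: (leqP n k) => [le | /ltnW le].
  by rewrite -(subnK le) iterD (fixd _ _ hn).
by rewrite -(subnK le) iterD (fixd _ _ hk).
Qed.

Definition id_machine : machine :=
  @Machine 0 unit unit tt xpredT (fun s _ => (s, [ffun=> (None, Stay)])).

Lemma computes_id (x : bitstring) : computes id_machine x x.
Proof.
exists 0; split=> //; rewrite /output /= !ffunE /=.
by case: x => //= b x; congr (_ :: _); elim: x => //= a x ->.
Qed.

Lemma CP (U : machine) (x : bitstring) :
  universal U -> is_shortest_length U x (C U x).
Proof.
move=> /(_ id_machine)[p /(_ x x (computes_id x)) Up].
pose P n := exists q, computes U q x /\ size q = n.
pose b n : bool := if excluded_middle_informative (P n) then true else false.
have bP n : reflect (P n) (b n).
  by rewrite /b; case: excluded_middle_informative => ?; constructor.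
have exb : exists n, b n by exists (size (pair_str p x)); apply/bP; exists (pair_str p x).
apply: epsilon_spec; case: (ex_minnP exb) => n /bP Pn minn; exists n; split=> // q Uq.
by apply: minn; apply/bP; exists q.
Qed.

(* Main.v *)
From Stdlib Require Import ZArith Lia FunctionalExtensionality Classical.
From mathcomp Require Import all_boot.
From mathcomp.zify Require Import zify_ssreflect.
Require Import Defs.

(** Among the halting programs of length at most m (enlarged by a constant, so that
    one exists) let p be a slowest one. From d = 0^j 1 p with |d| = m + 1, which costs
    m + O(1) bits to hard-wire, a machine can recover both m and the running time t of
    p, and every program of length at most m that halts at all halts within t steps.
    On input x the machine therefore runs all programs of length at most m + 1, in
    order of length, for t steps each, and returns the first one that prints x; if
    there is none, it returns the literal description of x.

    The simulation of U writes the overwritten symbols and states on the clock tape,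
    so that it can be undone; this restores the tapes of U before the next candidate
    program is tried. *)

(** Halting is undecidable, yet q has to be defined on every string. One time bound settles which of
    the short programs halt; writing this bound out could take far more than m bits, whereas [p]
    encodes it within the bits available. [universal] only makes the machine a program on pairs of
    [d] and x; [hardwires_data] then absorbs [d] at the price |d| + O(1). This price leaves no room
    for a second datum beside [p], but the padding fixes |d|, so that the length itself carries m.
    Candidates of length |d| are tried although the time bound does not cover them. This is
    harmless: whatever is accepted does print x, and completeness matters only up to length m. The
    rest of the work is to exhibit the machine. [U] is arbitrary, with any number of tapes, so the
    algorithm is a while program over the tapes of [U] and four more, compiled to a transition
    function. Its correctness is shown on integer-indexed tapes, where an erased cell is the same as
    one never visited. *)

Set Implicit Arguments.
Unset Strict Implicit.
Unset Printing Implicit Defensive.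

(** * Tapes as functions on the integers *)

Section Ztape.
Variable G : Type.

(* Unlike [tape], this does not distinguish a listed blank from an unlisted one. *)
Definition ztape := (Z * (Z -> symbol G))%type.

Definition upd (f : Z -> symbol G) (p : Z) (a : symbol G) : Z -> symbol G :=
  fun i => if (i =? p)%Z then a else f i.

Definition zread (z : ztape) : symbol G := z.2 z.1.

Definition delta (d : move) : Z :=
  match d with MoveLeft => -1 | Stay => 0 | MoveRight => 1 end%Z.

Definition zact (a : symbol G * move) (z : ztape) : ztape :=
  ((z.1 + delta a.2)%Z, upd z.2 z.1 a.1).

(** The default [None] of [nth] supplies the unlisted blanks. The origin of the integer tape is
    arbitrary, so a machine may be started at any cell. *)
Definition rep (t : tape G) (z : ztape) : Prop :=
  [/\ scanned t = zread z,
      forall i, nth None (cells_left t) i = z.2 (z.1 - 1 - Z.of_nat i)%Z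
    & forall i, nth None (cells_right t) i = z.2 (z.1 + 1 + Z.of_nat i)%Z].

Lemma upd_eq f p a : upd f p a p = a.
Proof. by rewrite /upd Z.eqb_refl. Qed.

Lemma upd_neq f p a i : i <> p -> upd f p a i = f i.
Proof. by move=> ne; rewrite /upd; case: Z.eqb_spec. Qed.

Lemma upd_same f p : upd f p (f p) = f.
Proof.
by apply: functional_extensionality => i; rewrite /upd; case: Z.eqb_spec => // ->.
Qed.

Lemma upd_upd f p a b : upd (upd f p a) p b = upd f p b.
Proof. by apply: functional_extensionality => i; rewrite /upd; case: Z.eqb_spec. Qed.

Lemma zact_stay (z : ztape) : zact (zread z, Stay) z = z.
Proof. by case: z => p f; rewrite /zact /zread /= upd_same Z.add_0_r. Qed.

Lemma zact_write (z : ztape) a : zact (a, Stay) z = (z.1, upd z.2 z.1 a).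
Proof. by rewrite /zact /= Z.add_0_r. Qed.

Lemma zact_move (z : ztape) d : zact (zread z, d) z = ((z.1 + delta d)%Z, z.2).
Proof. by rewrite /zact /= upd_same. Qed.

Lemma rep_act t z a d : rep t z -> rep (shift d (write a t)) (zact (a, d) z).
Proof.
case: t z => l c r [p f] [/= sc hl hr].
have offl i : (p - 1 - Z.of_nat i.+1 = p - 1 - 1 - Z.of_nat i)%Z by lia.
have offr i : (p + 1 + Z.of_nat i.+1 = p + 1 + 1 + Z.of_nat i)%Z by lia.
case: d; split; rewrite /zread /= ?Z.add_0_r ?upd_eq //.
- by rewrite upd_neq -?nth0 ?hl; [congr f|]; lia.
- move=> i; rewrite upd_neq ?nth_behead ?hl; [congr f|]; lia.
- move=> [|i]; first by rewrite -[LHS](upd_eq f p); congr upd; lia.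
  rewrite upd_neq /= ?hr; [congr f|]; lia.
- by move=> i; rewrite upd_neq ?hl //; lia.
- by move=> i; rewrite upd_neq ?hr //; lia.
- by rewrite upd_neq -?nth0 ?hr; [congr f|]; lia.
- move=> [|i]; first by rewrite -[LHS](upd_eq f p); congr upd; lia.
  rewrite upd_neq /= ?hl; [congr f|]; lia.
- move=> i; rewrite upd_neq ?nth_behead ?hr; [congr f|]; lia.
Qed.

Definition bit_syms (r : bitstring) : seq (symbol G) := [seq Some (inl b) | b <- r].

Definition isbit (a : symbol G) : bool := if a is Some (inl _) then true else false.

Definition fill (s : Z) (l : seq (symbol G)) : Z -> symbol G :=
  fun i => if (s <=? i)%Z then nth None l (Z.to_nat (i - s)) else None.

(** The second clause makes the block maximal, as in [leading_bits]. Nothing is asked of the cells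
    left of the head, where remnants of the computation may stay. *)
Definition reads (z : ztape) (y : bitstring) : Prop :=
  (forall i, i < size y -> z.2 (z.1 + Z.of_nat i)%Z = Some (inl (nth false y i))) /\
  isbit (z.2 (z.1 + Z.of_nat (size y))%Z) = false.

Lemma fill_nth s l k : fill s l (s + Z.of_nat k) = nth None l k.
Proof.
rewrite /fill; case: Z.leb_spec; last by lia.
by move=> _; congr nth; lia.
Qed.

Lemma fill_lt s l i : (i < s)%Z -> fill s l i = None.
Proof. by rewrite /fill; case: Z.leb_spec => //; lia. Qed.

Lemma fill_size s l : fill s l (s + Z.of_nat (size l)) = None.
Proof. by rewrite fill_nth nth_default. Qed.

Lemma fill_head s a l : fill s (a :: l) s = a.
Proof. by have := fill_nth s (a :: l) 0; rewrite Z.add_0_r. Qed.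

Lemma fill_cat s l1 a l2 : fill s (l1 ++ a :: l2) (s + Z.of_nat (size l1)) = a.
Proof. by rewrite fill_nth nth_cat ltnn subnn. Qed.

Lemma upd_fill s l k a :
  upd (fill s l) (s + Z.of_nat k) a = fill s (set_nth None l k a).
Proof.
apply: functional_extensionality => i; rewrite /upd /fill.
case: Z.eqb_spec => [->|ne]; case: Z.leb_spec => // le; try lia.
  by rewrite nth_set_nth /= (_ : Z.to_nat _ = k) ?eqxx //; lia.
by rewrite nth_set_nth /= (_ : (_ == k) = false) //; lia.
Qed.

Lemma upd_fill_cat s l1 a l2 b :
  upd (fill s (l1 ++ a :: l2)) (s + Z.of_nat (size l1)) b = fill s (l1 ++ b :: l2).
Proof. by rewrite upd_fill; congr fill; elim: l1 => //= c l1 ->. Qed.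

Lemma upd_fill_size s l a : upd (fill s l) (s + Z.of_nat (size l)) a = fill s (rcons l a).
Proof. by rewrite upd_fill; congr fill; elim: l => //= b l ->. Qed.

Lemma fill_rcons_blank s l : fill s (rcons l None) = fill s l.
Proof. by rewrite -upd_fill_size -(fill_size s l) upd_same. Qed.

Lemma upd_fill_last s l a : upd (fill s (rcons l a)) (s + Z.of_nat (size l)) None = fill s l.
Proof. by rewrite -cats1 upd_fill_cat cats1 fill_rcons_blank. Qed.

(** Erasing from the left only moves the anchor, so loops that consume their input never leave the
    normal form [fill]. *)
Lemma upd_fill_head s a l : upd (fill s (a :: l)) s None = fill (s + 1) l.
Proof.
apply: functional_extensionality => i; rewrite /upd /fill.
case: Z.eqb_spec => [->|ne]; first by case: Z.leb_spec => //; lia.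
case: Z.leb_spec => h1; case: Z.leb_spec => h2 //; try lia.
by rewrite (_ : Z.to_nat (i - s) = (Z.to_nat (i - (s + 1))).+1) //; lia.
Qed.

Lemma rep_tape_of s l : rep (tape_of l) (s, fill s l).
Proof.
split=> [|i|i]; rewrite /zread /=.
- by rewrite -nth0 -(fill_nth s l 0) Z.add_0_r.
- by rewrite nth_nil fill_lt //; lia.
- by rewrite nth_behead -(fill_nth s); congr fill; lia.
Qed.

Lemma leading_bitsP (l : seq (symbol G)) y :
  leading_bits l = y <->
  (forall i, i < size y -> nth None l i = Some (inl (nth false y i))) /\
  isbit (nth None l (size y)) = false.
Proof.
elim: l y => [|a l IH] y /=.
  split=> [<-|] //; case: y => //= b y [/(_ 0 isT)] //.
case: a => [[b|g]|]; last 2 first.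
- by split=> [<-|] //; case: y => //= b y [/(_ 0 isT)].
- by split=> [<-|] //; case: y => //= b y [/(_ 0 isT)].
case: y => [|c y] /=; first by split=> // -[].
split=> [[<- /IH[h1 h2]]|[h1 h2]]; first by split=> // -[|i] //= /h1.
by have [->] := h1 0 isT; congr (_ :: _); apply/IH; split=> // i; apply: (h1 i.+1).
Qed.

Lemma rep_reads t z y :
  rep t z -> leading_bits (scanned t :: cells_right t) = y <-> reads z y.
Proof.
move=> [sc _ hr].
have E i : nth None (scanned t :: cells_right t) i = z.2 (z.1 + Z.of_nat i)%Z.
  case: i => [|i] /=; first by rewrite Z.add_0_r.
  by rewrite hr; congr z.2; lia.
by rewrite leading_bitsP /reads E; split=> -[h ->]; split=> // i /h; rewrite E.
Qed.

End Ztape.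

Lemma fill_map (G H : Type) (h : symbol G -> symbol H) s l :
  h None = None -> h \o fill s l = fill s (map h l).
Proof.
move=> h0; apply: functional_extensionality => i; rewrite /= /fill.
by case: ifP => // _; elim: l (Z.to_nat _) => [|a l IH] [|k] //=.
Qed.

(** * Machine steps on integer tapes *)

Definition zconfig (M : machine) : Type :=
  (state M * ('I_(work_tapes M).+1 -> ztape (aux M)))%type.

Definition zstep (M : machine) (c : zconfig M) : zconfig M :=
  if halting c.1 then c else
  let a := trans c.1 [ffun i => zread (c.2 i)] in
  (a.1, fun i => zact (a.2 i) (c.2 i)).

Definition crep (M : machine) (c : config M) (z : zconfig M) : Prop :=
  c.1 = z.1 /\ forall i, rep (c.2 i) (z.2 i).

Lemma crep_iter (M : machine) k (c : config M) (z : zconfig M) :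
  crep c z -> crep (iter k (@step M) c) (iter k (@zstep M) z).
Proof.
move=> h0; elim: k => //= k; move: (iter k _ c) (iter k _ z) => {h0}c {}z [e h].
rewrite /step /zstep e; case: ifP => // _.
have -> : [ffun i => scanned (c.2 i)] = [ffun i => zread (z.2 i)].
  by apply/ffunP => i; rewrite !ffunE; case: (h i).
split=> // i; rewrite ffunE /=; case: (_ i) => a d; exact: rep_act.
Qed.

(** * A while language on several tapes, and its compilation *)

Section Language.
Variables (I : eqType) (G : finType).

Definition store := I -> ztape G.

Definition view (s : store) : I -> symbol G := fun i => zread (s i).

Definition perform (a : I -> symbol G * move) (s : store) : store :=
  fun i => zact (a i) (s i).

(** Tests and actions are arbitrary functions of all scanned symbols, so a single [Act] can carry
    out a step of another machine. *)
Inductive com :=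
| Act (f : (I -> symbol G) -> I -> symbol G * move)
| Seq (c1 c2 : com)
| If (b : (I -> symbol G) -> bool) (c1 c2 : com)
| While (b : (I -> symbol G) -> bool) (c : com).

(** A relation, since loops may diverge; only terminating runs are ever needed. *)
Inductive exec : com -> store -> store -> Prop :=
| ExecAct f s : exec (Act f) s (perform (f (view s)) s)
| ExecSeq c1 c2 s1 s2 s3 : exec c1 s1 s2 -> exec c2 s2 s3 -> exec (Seq c1 c2) s1 s3
| ExecIf b c1 c2 s s' :
    exec (if b (view s) then c1 else c2) s s' -> exec (If b c1 c2) s s'
| ExecDone b c s : b (view s) = false -> exec (While b c) s s
| ExecLoop b c s1 s2 s3 :
    b (view s1) = true -> exec c s1 s2 -> exec (While b c) s2 s3 -> exec (While b c) s1 s3.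

(** The additional [None] of [If] and [While] is the state in which the guard is tested. *)
Fixpoint ctrl (c : com) : finType :=
  match c with
  | Act _ => unit
  | Seq c1 c2 => (ctrl c1 + ctrl c2)%type
  | If _ c1 c2 => option (ctrl c1 + ctrl c2)%type
  | While _ c1 => option (ctrl c1)
  end.

Fixpoint entry (c : com) : ctrl c :=
  match c with
  | Act _ => tt
  | Seq c1 c2 => inl (entry c1)
  | If _ _ _ => None
  | While _ _ => None
  end.

Definition idle (v : I -> symbol G) : I -> symbol G * move := fun i => (v i, Stay).

(* The control state [None] in the result means that [c] has terminated. *)
Fixpoint ctrl_trans (c : com) :
    ctrl c -> (I -> symbol G) -> option (ctrl c) * (I -> symbol G * move) :=
  match c with
  | Act f => fun _ v => (None, f v)
  | Seq c1 c2 => fun k v =>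
      match k with
      | inl k1 => let r := ctrl_trans k1 v in
                  (Some (if r.1 is Some k1' then inl k1' else inr (entry c2)), r.2)
      | inr k2 => let r := ctrl_trans k2 v in (omap inr r.1, r.2)
      end
  | If b c1 c2 => fun k v =>
      match k with
      | None => (Some (Some (if b v then inl (entry c1) else inr (entry c2))), idle v)
      | Some (inl k1) => let r := ctrl_trans k1 v in (omap (fun x => Some (inl x)) r.1, r.2)
      | Some (inr k2) => let r := ctrl_trans k2 v in (omap (fun x => Some (inr x)) r.1, r.2)
      end
  | While b c1 => fun k v =>
      match k with
      | None => (if b v then Some (Some (entry c1)) else None, idle v)
      | Some k1 => let r := ctrl_trans k1 v in (Some r.1, r.2)
      end
  end.

Definition ctrl_step (c : com) (x : option (ctrl c) * store) :=
  if x.1 is Some k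
  then let r := ctrl_trans k (view x.2) in (r.1, perform r.2 x.2)
  else x.

Definition reach (c : com) (x y : option (ctrl c) * store) : Prop :=
  exists k, iter k (@ctrl_step c) x = y.

Lemma reach_trans c (x y z : option (ctrl c) * store) :
  reach x y -> reach y z -> reach x z.
Proof. by move=> [j <-] [k <-]; exists (k + j); rewrite iterD. Qed.

Lemma reach_step c (x y : option (ctrl c) * store) : ctrl_step x = y -> reach x y.
Proof. by exists 1. Qed.

(** [h] places the control of [c1] inside that of [c], and [h None] is where [c] goes on once [c1]
    has ended: the entry of the second command, the guard of the loop, or termination. The
    hypothesis omits [None], because there [c1] stands still while [c] may proceed. *)
Lemma reach_embed (c1 c : com) (h : option (ctrl c1) -> option (ctrl c)) :
  (forall k s, ctrl_step (h (Some k), s) =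
     (h (ctrl_step (Some k, s)).1, (ctrl_step (Some k, s)).2)) ->
  forall k s s', reach (Some k, s) (None, s') -> reach (h (Some k), s) (h None, s').
Proof.
move=> hh k s s' [n]; elim: n k s => [|n IH] k s //.
rewrite iterSr; move: (hh k s); case E: (ctrl_step (Some k, s)) => [[k'|] s1] /= hh1.
  by move/IH; apply/reach_trans/reach_step.
move=> En; apply: reach_step; rewrite hh1; congr (_, _).
(* A terminated command is fixed by [ctrl_step], so the remaining steps leave the store alone. *)
by move: En; elim: n {IH} => [[]|n IH] //=; rewrite -iterS iterSr.
Qed.

Lemma perform_idle s : perform (idle (view s)) s = s.
Proof. by apply: functional_extensionality => i; rewrite /perform zact_stay. Qed.

Lemma exec_reach c s s' : exec c s s' -> reach (Some (entry c), s) (None, s').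
Proof.
elim=> {c s s'}.
- by move=> f s; apply: reach_step.
- move=> c1 c2 s1 s2 s3 _ IH1 _ IH2.
  pose h1 o : option (ctrl (Seq c1 c2)) :=
    Some (if o is Some k then inl k else inr (entry c2)).
  apply: (@reach_trans _ _ (h1 None, s2)).
    by apply: (@reach_embed c1 _ h1).
  exact: (@reach_embed c2 (Seq c1 c2) (omap inr)).
- move=> b c1 c2 s s' _ IH.
  pose c := If b c1 c2.
  pose k : option (ctrl c) :=
    Some (Some (if b (view s) then inl (entry c1) else inr (entry c2))).
  apply: (@reach_trans _ _ (k, s)).
    by apply: reach_step; rewrite /ctrl_step /= perform_idle.
  rewrite {}/k; case: (b (view s)) IH.
    exact: (@reach_embed c1 c (omap (fun x => Some (inl x)))).
  exact: (@reach_embed c2 c (omap (fun x => Some (inr x)))).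
- by move=> b c s bs; apply: reach_step; rewrite /ctrl_step /= bs perform_idle.
- move=> b c s1 s2 s3 bs _ IH1 _; apply: reach_trans.
  pose k : option (ctrl (While b c)) := Some (Some (entry c)).
  apply: (@reach_trans _ _ (k, s1)).
    by apply: reach_step; rewrite /ctrl_step /= bs perform_idle.
  exact: (@reach_embed c (While b c) Some).
Qed.

Definition set (s : store) (i : I) (z : ztape G) : store :=
  fun k => if k == i then z else s k.

Definition Wr (i : I) (f : (I -> symbol G) -> symbol G) : com :=
  Act (fun v k => (if k == i then f v else v k, Stay)).

Definition Mv (i : I) (d : move) : com :=
  Act (fun v k => (v k, if k == i then d else Stay)).

Lemma exec_Wr i f s : exec (Wr i f) s (set s i ((s i).1, upd (s i).2 (s i).1 (f (view s)))).
Proof.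
suff -> : set s i ((s i).1, upd (s i).2 (s i).1 (f (view s)))
  = perform (fun k => (if k == i then f (view s) else view s k, Stay)) s.
  exact: ExecAct.
apply: functional_extensionality => k; rewrite /set /perform /view.
by case: eqP => [->|_]; [rewrite zact_write | rewrite zact_stay].
Qed.

Lemma exec_Mv i d s : exec (Mv i d) s (set s i (((s i).1 + delta d)%Z, (s i).2)).
Proof.
suff -> : set s i (((s i).1 + delta d)%Z, (s i).2)
  = perform (fun k => (view s k, if k == i then d else Stay)) s.
  exact: ExecAct.
apply: functional_extensionality => k; rewrite /set /perform /view.
by case: eqP => [->|_]; [rewrite zact_move | rewrite zact_stay].
Qed.

Lemma exec_eq c s s1 s2 : exec c s s1 -> s1 = s2 -> exec c s s2.
Proof. by move=> h <-. Qed.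

End Language.

Arguments Mv {I G}.

Section Compile.
Variables (w e : nat) (G : finType).
Notation I := ('I_w.+1 + 'I_e)%type.

(** [(w + e).+1] and [w.+1 + e] are convertible, so [split] distributes the tapes over the two
    summands of [I], tape 0 going to [inl ord0]. *)
Definition compile (c : com I G) : machine :=
  @Machine (w + e) (option (ctrl c)) G (Some (entry c)) (fun k => ~~ isSome k)
    (fun o v =>
       if o is Some k
       then let r := ctrl_trans k (fun i => v (@unsplit w.+1 e i)) in
            (r.1, [ffun j => r.2 (@split w.+1 e j)])
       else (None, [ffun j => (v j, Stay)])).

Definition input_store (x : bitstring) : store I G :=
  fun i => (0%Z, fill 0 (if i == inl ord0 then bit_syms G x else [::])).

Lemma exec_computes (c : com I G) x s y :
  exec c (input_store x) s -> reads (s (inl ord0)) y -> computes (compile c) x y.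
Proof.
move=> /exec_reach [k Ek] hy; exists k.
pose flat (s : store I G) : 'I_(w + e).+1 -> ztape G := fun j => s (@split w.+1 e j).
have flat_step o s1 :
    @zstep (compile c) (o, flat s1) = let r := ctrl_step (o, s1) in (r.1, flat r.2).
  case: o => [k1|] //; rewrite /zstep /ctrl_step /=.
  have -> : (fun i => [ffun j => zread (flat s1 j)] (@unsplit w.+1 e i)) = view s1.
    by apply: functional_extensionality => i; rewrite ffunE /flat unsplitK.
  by congr (_, _); apply: functional_extensionality => j; rewrite ffunE.
have flat_iter : iter k (@zstep (compile c)) (Some (entry c), flat (input_store x))
    = (None, flat s).
  have: forall n o s1, iter n (@zstep (compile c)) (o, flat s1) =
      let r := iter n (@ctrl_step _ _ c) (o, s1) in (r.1, flat r.2).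
    by elim=> [|n IH] o s1 //=; rewrite IH flat_step; case: (iter _ _ _).
  by move->; rewrite Ek.
have split0 : @split w.+1 e (@ord0 (w + e)) = inl ord0.
  rewrite -[RHS](@unsplitK w.+1 e); congr split; exact: val_inj.
have /(crep_iter k) : crep (init (compile c) x) (Some (entry c), flat (input_store x)).
  split=> // j; rewrite ffunE /flat /input_store.
  have -> : (j == ord0) = (@split w.+1 e j == inl ord0).
    by rewrite -split0 (can_eq (@splitK w.+1 e)).
  by rewrite /bit_syms; exact: rep_tape_of.
rewrite flat_iter => -[/= e1 hrep]; split; first by rewrite e1.
by rewrite /output; apply/(rep_reads _ (hrep ord0)); rewrite /flat split0.
Qed.

End Compile.

Arguments Z.of_nat : simpl never.
Arguments Z.add : simpl never.
Arguments Z.sub : simpl never.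

(** * Straight-line execution *)

Section ExecRules.
Variables (I : eqType) (G : finType).
Implicit Types (b : (I -> symbol G) -> bool) (c : com I G) (s : store I G).

Lemma exec_seqA c1 c2 c3 s s' :
  exec (Seq c1 (Seq c2 c3)) s s' -> exec (Seq (Seq c1 c2) c3) s s'.
Proof.
move=> h; inversion h as [|? ? ? s1 ? h1 h23| | |]; subst.
inversion h23 as [|? ? ? s2 ? h2 h3| | |]; subst.
exact: ExecSeq (ExecSeq h1 h2) h3.
Qed.

(** One round is unrolled in front of the loop; after reassociation by [exec_seqA] it is executed
    like straight-line code. *)
Lemma exec_loop b c s s' :
  b (view s) -> exec (Seq c (While b c)) s s' -> exec (While b c) s s'.
Proof.
move=> bs h; inversion h as [|? ? ? s1 ? h1 h2| | |]; subst.
exact: ExecLoop bs h1 h2.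
Qed.

(** Ends straight-line blocks, because the rules for single instructions expect a command to
    follow. *)
Definition Skip : com I G := Act (@idle I G).

Lemma exec_skip s : exec Skip s s.
Proof. by rewrite -{2}(perform_idle s); exact: ExecAct. Qed.

End ExecRules.

Arguments Skip {I G}.

(** * Enumerating strings by length *)

(* Bits are listed least significant first: the digits false and true stand for 1
   and 2 in bijective base 2, so that every string is reached exactly once. *)
Fixpoint inc (r : bitstring) : bitstring :=
  match r with
  | [::] => [:: false]
  | true :: r' => false :: inc r'
  | false :: r' => true :: r'
  end.

Fixpoint rank (r : bitstring) : nat := if r is b :: r' then (b + (rank r').*2).+1 else 0.

Definition nth_string (n : nat) : bitstring := iter n inc [::].

Lemma rank_inc r : rank (inc r) = (rank r).+1.
Proof. by elim: r => [|[] r IH] //=; rewrite IH; lia. Qed.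

Lemma rank_inj : injective rank.
Proof.
elim=> [|b r IH] [|c r'] //= [E].
have [-> /IH ->] // : b = c /\ rank r = rank r'.
by case: b c E => -[] /= E; split; lia.
Qed.

Lemma nth_string_rank r : nth_string (rank r) = r.
Proof.
by apply: rank_inj; elim: (rank r) => // n IH; rewrite /nth_string iterS rank_inc IH.
Qed.

Lemma size_inc r : size r <= size (inc r).
Proof. by elim: r => [|[] r IH] /=. Qed.

Lemma size_nth_string m n : m <= n -> size (nth_string m) <= size (nth_string n).
Proof.
move=> /subnK <-; rewrite /nth_string iterD; elim: (n - m) => //= k IH.
exact: leq_trans IH (size_inc _).
Qed.

(** With all digits equal to 2, [nseq M true] is the last string of length at most M; its rank ends
    the search. *)
Lemma rank_max M r : size r <= M -> rank r <= rank (nseq M true).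
Proof. by elim: M r => [|M IH] [|b r] //= /IH; case: b; lia. Qed.

Lemma size_nth_string_max M n : n <= rank (nseq M true) -> size (nth_string n) <= M.
Proof. by move/size_nth_string; rewrite nth_string_rank size_nseq. Qed.

(** The form in which the machine increments: flip the leading block of [true], then change or
    append one digit. *)
Lemma inc_carry r : exists k r',
  [/\ r = nseq k true ++ r', head false r' = false &
      inc r = nseq k false ++ (if r' is _ :: r'' then true :: r'' else [:: false])].
Proof.
elim: r => [|[] r [k [r' [E h Ei]]]]; first by exists 0, [::].
  by exists k.+1, r'; rewrite /= -E -Ei.
by exists 0, (false :: r).
Qed.

Local Notation "a ;; b" := (Seq a b) (at level 90, right associativity).

(** * The tapes of the compressing machine and the rules for its instructions *)

Section Program.
Variable U : machine.
Notation w := (work_tapes U).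

(** All that is needed to undo one step of [U], as a single symbol, so that one cell of the clock
    holds one step. *)
Definition record : finType := (state U * {ffun 'I_w.+1 -> option (bool + aux U)})%type.
Definition alphabet : finType := (aux U + (state U + record))%type.
Notation sym := (symbol alphabet).
Notation I := ('I_w.+1 + 'I_4)%type.
Notation bit b := (Some (inl b) : sym).
Notation bits := (bit_syms alphabet).

Definition emb (a : symbol (aux U)) : sym :=
  match a with
  | Some (inl b) => bit b
  | Some (inr g) => Some (inr (inl g))
  | None => None
  end.

Definition dec (a : sym) : symbol (aux U) :=
  match a with
  | Some (inl b) => Some (inl b)
  | Some (inr (inl g)) => Some (inr g)
  | _ => None
  end.

Lemma embK : cancel emb dec.
Proof. by case=> [[]|]. Qed.

Definition state_sym (s : state U) : sym := Some (inr (inr (inl s))).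
Definition record_sym (r : record) : sym := Some (inr (inr (inr r))).

(* [Zi] is the input tape of U. The tape [Xi] holds the string x, [Li] as many
   marks as the longest candidate program has bits, [Ti] the clock, and [Qi] the
   state of U or the outcome of the last trial. *)
Definition Zi : I := inl ord0.
Definition Xi : I := inr (@Ordinal 4 0 isT).
Definition Li : I := inr (@Ordinal 4 1 isT).
Definition Ti : I := inr (@Ordinal 4 2 isT).
Definition Qi : I := inr (@Ordinal 4 3 isT).

(** [z] overrides [v ord0], so the input tape can change while [v] is kept. *)
Definition mk (z : ztape alphabet) (v : 'I_w.+1 -> ztape alphabet)
    (x l t q : ztape alphabet) : store I alphabet :=
  fun i => match i with
  | inl j => if j == ord0 then z else v j
  | inr k => match val k with 0 => x | 1 => l | 2 => t | _ => q end
  end.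

Lemma mk_congr z v v' x l t q :
  (forall j, j != ord0 -> v j = v' j) -> mk z v x l t q = mk z v' x l t q.
Proof.
by move=> h; apply: functional_extensionality => -[j|//] /=; case: eqP => // /eqP /h.
Qed.

Lemma set_mkZ z z' v x l t q : set (mk z v x l t q) Zi z' = mk z' v x l t q.
Proof.
apply: functional_extensionality => -[j|//]; rewrite /set /= /Zi.
by case: (j =P ord0) => [->|/eqP/negbTE ne]; rewrite ?eqxx // /eq_op /= ne.
Qed.

Lemma set_mkX z v x x' l t q : set (mk z v x l t q) Xi x' = mk z v x' l t q.
Proof. by apply: functional_extensionality => -[j|[[|[|[|[|k]]]] h]]. Qed.

Lemma set_mkL z v x l l' t q : set (mk z v x l t q) Li l' = mk z v x l' t q.
Proof. by apply: functional_extensionality => -[j|[[|[|[|[|k]]]] h]]. Qed.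

Lemma set_mkT z v x l t t' q : set (mk z v x l t q) Ti t' = mk z v x l t' q.
Proof. by apply: functional_extensionality => -[j|[[|[|[|[|k]]]] h]]. Qed.

Lemma set_mkQ z v x l t q q' : set (mk z v x l t q) Qi q' = mk z v x l t q'.
Proof. by apply: functional_extensionality => -[j|[[|[|[|[|k]]]] h]]. Qed.

Lemma viewZ zp zf v x l t q : view (mk (zp, zf) v x l t q) Zi = zf zp.
Proof. by []. Qed.

Lemma viewX z v xp xf l t q : view (mk z v (xp, xf) l t q) Xi = xf xp.
Proof. by []. Qed.

Lemma viewL z v x lp lf t q : view (mk z v x (lp, lf) t q) Li = lf lp.
Proof. by []. Qed.

Lemma viewT z v x l tp tf q : view (mk z v x l (tp, tf) q) Ti = tf tp.
Proof. by []. Qed.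

Lemma viewQ z v x l t qp qf : view (mk z v x l t (qp, qf)) Qi = qf qp.
Proof. by []. Qed.

Definition viewE := (viewZ, viewX, viewL, viewT, viewQ).

Lemma seq_wr (i : I) f (c : com I alphabet) s s' :
  exec c (set s i ((s i).1, upd (s i).2 (s i).1 (f (view s)))) s' -> exec (Wr i f ;; c) s s'.
Proof. by apply: ExecSeq; apply: exec_Wr. Qed.

Lemma seq_mv (i : I) d (c : com I alphabet) s s' :
  exec c (set s i (((s i).1 + delta d)%Z, (s i).2)) s' -> exec (Mv i d ;; c) s s'.
Proof. by apply: ExecSeq; apply: exec_Mv. Qed.

Lemma seq_wrZ f c zp zf v x l t q s' :
  exec c (mk (zp, upd zf zp (f (view (mk (zp, zf) v x l t q)))) v x l t q) s' ->
  exec (Wr Zi f ;; c) (mk (zp, zf) v x l t q) s'.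
Proof. by move=> h; apply: seq_wr; rewrite set_mkZ. Qed.

Lemma seq_wrX f c z v xp xf l t q s' :
  exec c (mk z v (xp, upd xf xp (f (view (mk z v (xp, xf) l t q)))) l t q) s' ->
  exec (Wr Xi f ;; c) (mk z v (xp, xf) l t q) s'.
Proof. by move=> h; apply: seq_wr; rewrite set_mkX. Qed.

Lemma seq_wrL f c z v x lp lf t q s' :
  exec c (mk z v x (lp, upd lf lp (f (view (mk z v x (lp, lf) t q)))) t q) s' ->
  exec (Wr Li f ;; c) (mk z v x (lp, lf) t q) s'.
Proof. by move=> h; apply: seq_wr; rewrite set_mkL. Qed.

Lemma seq_wrQ f c z v x l t qp qf s' :
  exec c (mk z v x l t (qp, upd qf qp (f (view (mk z v x l t (qp, qf)))))) s' ->
  exec (Wr Qi f ;; c) (mk z v x l t (qp, qf)) s'.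
Proof. by move=> h; apply: seq_wr; rewrite set_mkQ. Qed.

Lemma seq_mvZ d c zp zf v x l t q s' :
  exec c (mk ((zp + delta d)%Z, zf) v x l t q) s' ->
  exec (Mv Zi d ;; c) (mk (zp, zf) v x l t q) s'.
Proof. by move=> h; apply: seq_mv; rewrite set_mkZ. Qed.

Lemma seq_mvX d c z v xp xf l t q s' :
  exec c (mk z v ((xp + delta d)%Z, xf) l t q) s' ->
  exec (Mv Xi d ;; c) (mk z v (xp, xf) l t q) s'.
Proof. by move=> h; apply: seq_mv; rewrite set_mkX. Qed.

Lemma seq_mvL d c z v x lp lf t q s' :
  exec c (mk z v x ((lp + delta d)%Z, lf) t q) s' ->
  exec (Mv Li d ;; c) (mk z v x (lp, lf) t q) s'.
Proof. by move=> h; apply: seq_mv; rewrite set_mkL. Qed.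

Lemma seq_mvT d c z v x l tp tf q s' :
  exec c (mk z v x l ((tp + delta d)%Z, tf) q) s' ->
  exec (Mv Ti d ;; c) (mk z v x l (tp, tf) q) s'.
Proof. by move=> h; apply: seq_mv; rewrite set_mkT. Qed.

Ltac straight :=
  repeat first
    [ apply: exec_seqA
    | apply: seq_wrZ; rewrite ?viewE | apply: seq_wrX; rewrite ?viewE
    | apply: seq_wrL; rewrite ?viewE | apply: seq_wrQ; rewrite ?viewE
    | apply: seq_mvZ | apply: seq_mvX | apply: seq_mvL | apply: seq_mvT ];
  rewrite /delta.

Definition is_bit_of (b : bool) (a : sym) : bool :=
  if a is Some (inl b') then b' == b else false.

(** * Reading the input *)

(** The unary length that [pair_str] puts in front of [d] is moved to [Li]. There it serves to find
    the end of [d], and later to bound the length of the candidates. *)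
Definition parse_header : com I alphabet :=
  While (fun v => is_bit_of true (v Zi))
    (Wr Zi (fun _ => None) ;; Mv Zi MoveRight ;; Wr Li (fun _ => bit true) ;; Mv Li MoveRight).

Lemma exec_parse_header n k zp r v x t q :
  exec parse_header
    (mk (zp, fill zp (bits (nseq n true ++ false :: r))) v x
        (Z.of_nat k, fill 0 (bits (nseq k true))) t q)
    (mk ((zp + Z.of_nat n)%Z, fill (zp + Z.of_nat n) (bits (false :: r))) v x
        (Z.of_nat (k + n), fill 0 (bits (nseq (k + n) true))) t q).
Proof.
elim: n k zp => [|n IH] k zp.
  by rewrite Z.add_0_r addn0; apply: ExecDone; rewrite viewE /= fill_head.
apply: exec_loop; first by rewrite viewE /= fill_head.
straight; rewrite upd_fill_head.
have := upd_fill_size 0 (bits (nseq k true)) (bit true).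
rewrite size_map size_nseq Z.add_0_l => ->.
rewrite -map_rcons -[rcons _ _]/(rcons (nseq k true) true).
have -> : rcons (nseq k true) true = nseq k.+1 true by elim: k {IH} => //= k ->.
have -> : (Z.of_nat k + 1 = Z.of_nat k.+1)%Z by lia.
have -> : (zp + Z.of_nat n.+1 = zp + 1 + Z.of_nat n)%Z by lia.
by rewrite -addSnnS; apply: IH.
Qed.

Definition skip_zeros : com I alphabet :=
  While (fun v => is_bit_of false (v Zi))
    (Wr Zi (fun _ => None) ;; Mv Zi MoveRight ;; Mv Li MoveLeft).

Lemma exec_skip_zeros j zp lp lf r v x t q :
  exec skip_zeros
    (mk (zp, fill zp (bits (nseq j false ++ true :: r))) v x (lp, lf) t q)
    (mk ((zp + Z.of_nat j)%Z, fill (zp + Z.of_nat j) (bits (true :: r))) v x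
        ((lp - Z.of_nat j)%Z, lf) t q).
Proof.
elim: j zp lp => [|j IH] zp lp.
  by rewrite Z.add_0_r Z.sub_0_r; apply: ExecDone; rewrite viewE /= fill_head.
apply: exec_loop; first by rewrite viewE /= fill_head.
straight; rewrite upd_fill_head.
have -> : (zp + Z.of_nat j.+1 = zp + 1 + Z.of_nat j)%Z by lia.
have -> : (lp - Z.of_nat j.+1 = lp + -1 - Z.of_nat j)%Z by lia.
exact: IH.
Qed.

Lemma isbit_fill_bits s r k : isbit (fill s (bits r) (s + Z.of_nat k)) = (k < size r).
Proof.
rewrite fill_nth; case: ltnP => h; first by rewrite (nth_map false).
by rewrite nth_default // size_map.
Qed.

(** Nothing separates [p] from x on the tape; the position of the head on [Li] counts the bits of
    [p] that remain. *)
Definition skip_data : com I alphabet :=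
  While (fun v => isbit (v Li)) (Mv Zi MoveRight ;; Mv Li MoveLeft).

Lemma exec_skip_data k r zp zf v x t q :
  k <= size r ->
  exec skip_data
    (mk (zp, zf) v x ((Z.of_nat k - 1)%Z, fill 0 (bits r)) t q)
    (mk ((zp + Z.of_nat k)%Z, zf) v x ((-1)%Z, fill 0 (bits r)) t q).
Proof.
elim: k zp => [|k IH] zp le.
  by rewrite Z.add_0_r; apply: ExecDone; rewrite viewE fill_lt.
have -> : (Z.of_nat k.+1 - 1 = 0 + Z.of_nat k)%Z by lia.
apply: exec_loop; first by rewrite viewE isbit_fill_bits.
straight.
have -> : (0 + Z.of_nat k + -1 = Z.of_nat k - 1)%Z by lia.
have -> : (zp + Z.of_nat k.+1 = zp + 1 + Z.of_nat k)%Z by lia.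
exact/IH/ltnW.
Qed.

Definition copy_ZX : com I alphabet :=
  While (fun v => isbit (v Zi))
    (Wr Xi (fun v => v Zi) ;; Mv Xi MoveRight ;; Mv Zi MoveRight).

Lemma exec_copy_ZX r p y zp v l t q :
  exec copy_ZX
    (mk ((zp + Z.of_nat (size (p ++ y)))%Z, fill zp (bits (p ++ y ++ r))) v
        (Z.of_nat (size y), fill 0 (bits y)) l t q)
    (mk ((zp + Z.of_nat (size (p ++ y ++ r)))%Z, fill zp (bits (p ++ y ++ r))) v
        (Z.of_nat (size (y ++ r)), fill 0 (bits (y ++ r))) l t q).
Proof.
elim: r y => [|b r IH] y.
  rewrite !cats0; apply: ExecDone.
  by rewrite viewE isbit_fill_bits ltnn.
have Zr : fill zp (bits (p ++ y ++ b :: r)) (zp + Z.of_nat (size (p ++ y))) = bit b.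
  by rewrite catA /bit_syms map_cat -(size_map (fun b => bit b)) fill_cat.
apply: exec_loop; first by rewrite viewE Zr.
straight; rewrite Zr.
have := upd_fill_size 0 (bits y) (bit b); rewrite Z.add_0_l size_map -map_rcons => ->.
have := IH (rcons y b); rewrite cat_rcons !size_cat size_rcons.
have -> : (Z.of_nat (size y).+1 = Z.of_nat (size y) + 1)%Z by lia.
have -> : (zp + Z.of_nat (size p + (size y).+1) = zp + Z.of_nat (size p + size y) + 1)%Z by lia.
by [].
Qed.

Definition erase_back : com I alphabet :=
  While (fun v => isbit (v Xi))
    (Wr Zi (fun _ => None) ;; Mv Xi MoveLeft ;; Mv Zi MoveLeft).

Lemma exec_erase_back r p y zp v l t q :
  exec erase_back
    (mk ((zp + Z.of_nat (size (p ++ y)) - 1)%Z, fill zp (bits (p ++ y))) v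
        ((Z.of_nat (size y) - 1)%Z, fill 0 (bits (y ++ r))) l t q)
    (mk ((zp + Z.of_nat (size p) - 1)%Z, fill zp (bits p)) v
        ((-1)%Z, fill 0 (bits (y ++ r))) l t q).
Proof.
elim/last_ind: y r => [|y b IH] r.
  by rewrite cats0; apply: ExecDone; rewrite viewE fill_lt.
have EX : (Z.of_nat (size (rcons y b)) - 1 = 0 + Z.of_nat (size y))%Z.
  by rewrite size_rcons; lia.
have EZ : (zp + Z.of_nat (size (p ++ rcons y b)) - 1 = zp + Z.of_nat (size (bits (p ++ y))))%Z.
  by rewrite size_map !size_cat size_rcons; lia.
rewrite EX EZ -rcons_cat /bit_syms map_rcons -/bit_syms.
apply: exec_loop.
  by rewrite viewE isbit_fill_bits size_cat size_rcons; lia.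
straight; rewrite upd_fill_last.
have := IH (b :: r); rewrite -cat_rcons size_map.
have -> : (zp + Z.of_nat (size (p ++ y)) + -1 = zp + Z.of_nat (size (p ++ y)) - 1)%Z by lia.
by have -> : (0 + Z.of_nat (size y) + -1 = Z.of_nat (size y) - 1)%Z by lia.
Qed.

Definition rewind_Z : com I alphabet := While (fun v => isbit (v Zi)) (Mv Zi MoveLeft).

Lemma exec_rewind_Z k p zp v x l t q :
  k <= size p ->
  exec rewind_Z
    (mk ((zp + Z.of_nat k - 1)%Z, fill zp (bits p)) v x l t q)
    (mk ((zp - 1)%Z, fill zp (bits p)) v x l t q).
Proof.
elim: k => [|k IH] le.
  by rewrite Z.add_0_r; apply: ExecDone; rewrite viewE fill_lt //; lia.
have -> : (zp + Z.of_nat k.+1 - 1 = zp + Z.of_nat k)%Z by lia.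
apply: exec_loop; first by rewrite viewE isbit_fill_bits.
straight.
by have -> : (zp + Z.of_nat k + -1 = zp + Z.of_nat k - 1)%Z; [lia | exact/IH/ltnW].
Qed.

Definition blank : ztape alphabet := (0%Z, fill 0 [::]).

Definition setup : com I alphabet :=
  parse_header ;; Mv Li MoveLeft ;; Wr Zi (fun _ => None) ;; Mv Zi MoveRight ;;
  skip_zeros ;; Wr Zi (fun _ => None) ;; Mv Zi MoveRight ;; Mv Li MoveLeft ;;
  skip_data ;; copy_ZX ;; Mv Xi MoveLeft ;; Mv Zi MoveLeft ;;
  erase_back ;; rewind_Z ;; Mv Zi MoveRight ;; Mv Xi MoveRight ;; Mv Li MoveRight ;; Skip.

Lemma exec_setup j p x (d := nseq j false ++ true :: p) :
  exists zp, exec setup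
    (mk (0%Z, fill 0 (bits (pair_str d x))) (fun _ => blank) blank blank blank blank)
    (mk (zp, fill zp (bits p)) (fun _ => blank) (0%Z, fill 0 (bits x))
        (0%Z, fill 0 (bits (nseq (size d) true))) blank blank).
Proof.
(* The cell of the first bit of [p]: before it lie the header of |d| ones and a zero, the j padding
   zeros and the separating [true]. *)
pose zp := (Z.of_nat (size d) + 1 + Z.of_nat j + 1)%Z; exists zp.
apply: ExecSeq; first exact: (exec_parse_header (size d) 0).
rewrite add0n Z.add_0_l; straight; rewrite upd_fill_head.
apply: ExecSeq; first by rewrite -catA; apply: exec_skip_zeros.
straight; rewrite upd_fill_head.
have sd : size d = j + (size p).+1 by rewrite size_cat size_nseq.
have -> : (Z.of_nat (size d) + -1 - Z.of_nat j + -1 = Z.of_nat (size p) - 1)%Z by lia.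
apply: ExecSeq; first by apply: exec_skip_data; rewrite size_nseq; lia.
apply: ExecSeq; first by have := exec_copy_ZX x p [::]; rewrite cats0; apply.
straight.
apply: ExecSeq.
  have := exec_erase_back [::] p x zp; rewrite cats0 /=.
  by apply.
apply: ExecSeq; first exact: exec_rewind_Z.
straight.
by have -> : (zp - 1 + 1 = zp)%Z; [lia | apply: exec_skip].
Qed.

(** * Running U with a clock, and undoing the run *)

Notation mark := (bit true).

Definition embz (z : ztape (aux U)) : ztape alphabet := (z.1, emb \o z.2).

Definition mku (V : 'I_w.+1 -> ztape (aux U)) := mk (embz (V ord0)) (embz \o V).

Definition cell (a : sym) : ztape alphabet := (0%Z, fill 0 [:: a]).

Lemma upd_cell (a b : sym) : upd (fill 0 [:: a]) 0 b = fill 0 [:: b].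
Proof. exact: (upd_fill_cat 0 [::]). Qed.

Lemma mkuE V x l t q (i : I) :
  mku V x l t q i = match i with
  | inl j => embz (V j)
  | inr k => match val k with 0 => x | 1 => l | 2 => t | _ => q end
  end.
Proof. by case: i => [j|//]; rewrite /mku /=; case: eqP => [->|]. Qed.

Lemma emb_upd f p a : emb \o upd f p a = upd (emb \o f) p (emb a).
Proof. by apply: functional_extensionality => i; rewrite /= /upd; case: ifP. Qed.

(* One step of U. What it destroys, namely the state and the scanned symbols, is
   recorded on the clock tape. *)
Definition sim_step : com I alphabet := Act (fun v =>
  if v Qi is Some (inr (inr (inl s))) then
    let a := [ffun j => dec (v (inl j))] in
    let r := trans s a in
    fun i => match i with
    | inl j => (emb (r.2 j).1, (r.2 j).2)
    | inr k => match val k with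
               | 2 => (record_sym (s, a), MoveRight)
               | 3 => (state_sym r.1, Stay)
               | _ => (v i, Stay)
               end
    end
  else idle v).

Definition record_of (c : zconfig U) : record := (c.1, [ffun j => zread (c.2 j)]).

Lemma exec_sim_step (c : zconfig U) x l tp tf :
  ~~ halting c.1 ->
  exec sim_step (mku c.2 x l (tp, tf) (cell (state_sym c.1)))
    (mku (zstep c).2 x l ((tp + 1)%Z, upd tf tp (record_sym (record_of c)))
       (cell (state_sym (zstep c).1))).
Proof.
case: c => s V /= hs; apply: exec_eq; first exact: ExecAct.
rewrite /zstep (negbTE hs) /=.
have -> : [ffun j => dec (view (mku V x l (tp, tf) (cell (state_sym s))) (inl j))]
    = [ffun j => zread (V j)].
  by apply/ffunP => j; rewrite !ffunE /view mkuE /zread /= embK.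
apply: functional_extensionality => i; rewrite /perform !mkuE.
case: i => [j|[[|[|[|[|k]]]] h]] //=.
- by rewrite /embz /zact /= emb_upd.
- exact: zact_stay.
- exact: zact_stay.
- by rewrite /zact /cell /= Z.add_0_r upd_cell.
Qed.

Definition inverse (d : move) : move :=
  match d with MoveLeft => MoveRight | Stay => Stay | MoveRight => MoveLeft end.

(** An action writes before it moves, so its reversal has to move first and takes two actions. The
    moves are recomputed from the record by [trans]. *)
Definition undo_move : com I alphabet := Act (fun v =>
  if v Ti is Some (inr (inr (inr (s, a)))) then
    fun i => if i is inl j then (v i, inverse ((trans s a).2 j).2) else (v i, Stay)
  else idle v).

Definition undo_write : com I alphabet := Act (fun v =>
  if v Ti is Some (inr (inr (inr (s, a)))) then
    fun i => match i with
    | inl j => (emb ((a : {ffun 'I_w.+1 -> symbol (aux U)}) j), Stay)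
    | inr k => if val k is 2 then (mark, MoveLeft) else (v i, Stay)
    end
  else idle v).

Lemma exec_undo_step (c : zconfig U) x l tp tf q :
  ~~ halting c.1 -> tf tp = record_sym (record_of c) ->
  exec (undo_move ;; undo_write) (mku (zstep c).2 x l (tp, tf) q)
    (mku c.2 x l ((tp - 1)%Z, upd tf tp mark) q).
Proof.
case: c => s V /= hs tfE; rewrite /zstep (negbTE hs) /=.
set a := (X in trans s X) in tfE *.
set V' := fun i : 'I_w.+1 => _.
(* The stage between the two actions: heads moved back, contents still those after the step. *)
pose V1 j := ((V j).1, (V' j).2).
apply: (@ExecSeq _ _ _ _ _ (mku V1 x l (tp, tf) q)).
  apply: exec_eq; first exact: ExecAct.
  rewrite {1}/view mkuE /zread /= tfE /record_sym /record_of /= -/a.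
  apply: functional_extensionality => i; rewrite /perform.
  case: i => [j|k]; last by rewrite /view zact_stay !mkuE.
  rewrite /view zact_move !mkuE /V1 /V' /embz /=; congr (_, _).
  by case: ((trans s a).2 j).2 => /=; lia.
apply: exec_eq; first exact: ExecAct.
rewrite {1}/view mkuE /zread /= tfE /record_sym /record_of /= -/a.
apply: functional_extensionality => i; rewrite /perform !mkuE.
case: i => [j|[[|[|[|[|k]]]] h]] //=; try exact: zact_stay.
rewrite zact_write /V1 /V' /embz /= emb_upd upd_upd ffunE /zread.
by case: (V j) => p f /=; rewrite -[emb (f p)]/((emb \o f) p) upd_same.
Qed.

Section Run.
Variable c0 : zconfig U.
Notation conf k := (iter k (@zstep U) c0).

(** In a clocked run k of the t marks have become records; the case k = t also describes a free run,
    whose records extend the tape. *)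
Definition clock (k t : nat) : seq sym :=
  mkseq (fun i => record_sym (record_of (conf i))) k ++ nseq (t - k) mark.

Definition run_store x l k t q := mku (conf k).2 x l (Z.of_nat k, fill 0 (clock k t)) q.

(** The maximum unites both kinds of run: it is t while marks remain, and k + 1 when the tape
    grows. *)
Lemma exec_run_step k t x l :
  ~~ halting (conf k).1 -> k <= t ->
  exec sim_step (run_store x l k t (cell (state_sym (conf k).1)))
    (run_store x l k.+1 (maxn t k.+1) (cell (state_sym (conf k.+1).1))).
Proof.
move=> nh le; apply: exec_eq; first exact: exec_sim_step.
rewrite /run_store -[X in upd _ X _]Z.add_0_l; congr mku.
have -> : (Z.of_nat k.+1 = Z.of_nat k + 1)%Z by lia.
congr (_, _); rewrite /clock mkseqS.
set R := mkseq _ k; have sR : k = size R by rewrite size_mkseq.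
rewrite {2}sR.
move: le; rewrite leq_eqVlt => /predU1P[<-|lt].
  by rewrite subnn (maxn_idPr (leqnSn k)) subnn !cats0 upd_fill_size.
by rewrite (maxn_idPl lt) -(subnSK lt) /= upd_fill_cat cat_rcons.
Qed.

Definition is_running (v : I -> sym) : bool :=
  if v Qi is Some (inr (inr (inl s))) then ~~ halting s else false.

Definition run_free : com I alphabet := While is_running sim_step.

Definition run_clocked : com I alphabet :=
  While (fun v => is_running v && isbit (v Ti)) sim_step.

Lemma exec_run_free n k x l :
  (forall i, i < k + n -> ~~ halting (conf i).1) -> halting (conf (k + n)).1 ->
  exec run_free (run_store x l k k (cell (state_sym (conf k).1)))
    (run_store x l (k + n) (k + n) (cell (state_sym (conf (k + n)).1))).
Proof.
elim: n k => [|n IH] k nh hh.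
  by rewrite addn0 in hh *; apply: ExecDone; rewrite /is_running /= hh.
have nhk : ~~ halting (conf k).1 by apply: nh; lia.
apply: ExecLoop; [exact: nhk | exact: exec_run_step | ].
by rewrite (maxn_idPr (leqnSn k)) -addSnnS; apply: IH; rewrite addSnnS.
Qed.

Lemma isbit_clock k t : k <= t -> isbit (fill 0 (clock k t) (Z.of_nat k)) = (k < t).
Proof.
move=> le; rewrite -[Z.of_nat k]Z.add_0_l fill_nth nth_cat size_mkseq ltnn subnn.
by case: (ltnP k t) => h; [rewrite -(subnSK h) | rewrite (eqP h)].
Qed.

Lemma clock_guard k t x l : k <= t ->
  let v := view (run_store x l k t (cell (state_sym (conf k).1))) in
  is_running v && isbit (v Ti) = ~~ halting (conf k).1 && (k < t).
Proof. by move=> le; rewrite -isbit_clock. Qed.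

Lemma exec_run_clocked n k t x l :
  k + n <= t -> (forall i, i < k + n -> ~~ halting (conf i).1) ->
  halting (conf (k + n)).1 || (k + n == t) ->
  exec run_clocked (run_store x l k t (cell (state_sym (conf k).1)))
    (run_store x l (k + n) t (cell (state_sym (conf (k + n)).1))).
Proof.
elim: n k => [|n IH] k le nh hh.
  rewrite addn0 in le hh *; apply: ExecDone; rewrite clock_guard //.
  by case/orP: hh => [->|/eqP ->]; rewrite ?ltnn ?andbF.
have nhk : ~~ halting (conf k).1 by apply: nh; lia.
apply: ExecLoop; [ | by apply: exec_run_step => //; lia | ].
  by rewrite clock_guard ?nhk; lia.
have -> : maxn t k.+1 = t by lia.
by rewrite -addSnnS; apply: IH; rewrite addSnnS.
Qed.

Definition is_record (a : sym) : bool :=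
  if a is Some (inr (inr (inr _))) then true else false.

(** Each record becomes a mark. After a clocked run this refills the clock; after a free run of t
    steps it creates a clock of t marks, which is how t is obtained from [p]. [Qi] is not touched,
    so a verdict written there survives. *)
Definition undo : com I alphabet :=
  Mv Ti MoveLeft ;; While (fun v => is_record (v Ti)) (undo_move ;; undo_write) ;;
  Mv Ti MoveRight ;; Skip.

Lemma exec_undo k t x l q :
  k <= t -> (forall i, i < k -> ~~ halting (conf i).1) ->
  exec undo (run_store x l k t q) (mku c0.2 x l (0%Z, fill 0 (nseq t mark)) q).
Proof.
move=> le nh; rewrite /run_store /mku; straight; rewrite -/(mku _).
have -> : (Z.of_nat k + -1 = Z.of_nat k - 1)%Z by lia.
apply: (@ExecSeq _ _ _ _ _ (mku c0.2 x l ((-1)%Z, fill 0 (nseq t mark)) q)); last first.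
  by rewrite /mku; straight; apply: exec_skip.
elim: k le nh => [|k IH] le nh.
  by rewrite /clock subn0; apply: ExecDone; rewrite /mku viewE fill_lt.
have E : (Z.of_nat k.+1 - 1 = 0 + Z.of_nat k)%Z by lia.
have sR : k = size (mkseq (fun i => record_sym (record_of (conf i))) k).
  by rewrite size_mkseq.
have rT : fill 0 (clock k.+1 t) (0 + Z.of_nat k) = record_sym (record_of (conf k)).
  by rewrite {2}sR /clock mkseqS cat_rcons fill_cat.
rewrite E; apply: ExecLoop.
- by rewrite /mku viewE rT.
- by apply: exec_undo_step rT; apply: nh.
have -> : upd (fill 0 (clock k.+1 t)) (0 + Z.of_nat k) mark = fill 0 (clock k t).
  by rewrite {2}sR /clock mkseqS cat_rcons upd_fill_cat -(subnSK le).
by rewrite Z.add_0_l; apply: IH; [exact: ltnW | move=> i h; apply/nh/ltnW].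
Qed.

End Run.

(** * Testing one candidate program *)

Definition rewind_XZ : com I alphabet :=
  While (fun v => isbit (v Xi)) (Mv Xi MoveLeft ;; Mv Zi MoveLeft).

Lemma exec_rewind_XZ k x zp zf v l t q :
  k <= size x ->
  exec rewind_XZ
    (mk ((zp + Z.of_nat k - 1)%Z, zf) v ((Z.of_nat k - 1)%Z, fill 0 (bits x)) l t q)
    (mk ((zp - 1)%Z, zf) v ((-1)%Z, fill 0 (bits x)) l t q).
Proof.
elim: k => [|k IH] le.
  by rewrite Z.add_0_r; apply: ExecDone; rewrite viewE fill_lt.
have -> : (Z.of_nat k.+1 - 1 = 0 + Z.of_nat k)%Z by lia.
apply: exec_loop; first by rewrite viewE isbit_fill_bits.
straight.
have -> : (0 + Z.of_nat k + -1 = Z.of_nat k - 1)%Z by lia.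
have -> : (zp + Z.of_nat k.+1 - 1 + -1 = zp + Z.of_nat k - 1)%Z by lia.
exact/IH/ltnW.
Qed.

Definition same_bit (a b : sym) : bool :=
  if a is Some (inl c) then is_bit_of c b else false.

Definition match_loop : com I alphabet :=
  While (fun v => same_bit (v Xi) (v Zi)) (Mv Xi MoveRight ;; Mv Zi MoveRight).

(** [y1] is the part already found equal. The loop stops at the first disagreement or at the end of
    x, so the output equals x exactly if all of x was passed and no further bit follows on [Zi]. *)
Lemma exec_match_loop y2 y1 zp zf v l t q
    (st := fun k => mk ((zp + Z.of_nat k)%Z, zf) v
                       (Z.of_nat k, fill 0 (bits (y1 ++ y2))) l t q) :
  (forall i, i < size y1 -> zf (zp + Z.of_nat i)%Z = bit (nth false y1 i)) ->
  exists k, [/\ k <= size (y1 ++ y2), exec match_loop (st (size y1)) (st k) &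
    k = size (y1 ++ y2) /\ isbit (zf (zp + Z.of_nat k)%Z) = false <->
    reads (zp, zf) (y1 ++ y2)].
Proof.
elim: y2 y1 @st => [|b y2 IH] y1 st hy1.
  exists (size y1); split; rewrite ?cats0 //.
    apply: ExecDone; rewrite viewE -[X in fill _ _ X]Z.add_0_l cats0.
    by rewrite fill_nth nth_default ?size_map.
  by split=> [[_ h]|[_ h]].
have Xb : fill 0 (bits (y1 ++ b :: y2)) (Z.of_nat (size y1)) = bit b.
  by rewrite -[Z.of_nat _]Z.add_0_l /bit_syms map_cat -(size_map (fun b => bit b)) fill_cat.
case E: (is_bit_of b (zf (zp + Z.of_nat (size y1))%Z)).
  have hy : forall i, i < size (rcons y1 b) ->
      zf (zp + Z.of_nat i)%Z = bit (nth false (rcons y1 b) i).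
    move=> i; rewrite size_rcons ltnS leq_eqVlt nth_rcons => /predU1P[->|lt].
      rewrite ltnn eqxx; move: E; rewrite /is_bit_of.
      by case: (zf _) => [[b'|]|] // /eqP ->.
    by rewrite lt hy1.
  have [k []] := IH _ hy; rewrite cat_rcons => le ex eqv; exists k; split=> //.
  apply: exec_loop; first by rewrite !viewE Xb.
  straight; move: ex; rewrite size_rcons.
  have -> : (zp + Z.of_nat (size y1).+1 = zp + Z.of_nat (size y1) + 1)%Z by lia.
  by have -> : (Z.of_nat (size y1).+1 = Z.of_nat (size y1) + 1)%Z by lia.
exists (size y1); split; first by rewrite size_cat leq_addr.
  by apply: ExecDone; rewrite !viewE Xb.
rewrite size_cat /=; split=> [[]|[h _]]; first by lia.
have := h (size y1); rewrite size_cat /= nth_cat ltnn subnn /= => h1.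
by move: E; rewrite h1 /= ?eqxx //; lia.
Qed.

Definition compare : com I alphabet :=
  match_loop ;; Wr Qi (fun v => bit (~~ isbit (v Xi) && ~~ isbit (v Zi))) ;;
  Mv Xi MoveLeft ;; Mv Zi MoveLeft ;; rewind_XZ ;; Mv Xi MoveRight ;; Mv Zi MoveRight ;;
  Skip.

(** Both heads return to their places, so that [undo] finds the tapes of [U] as the run left
    them. *)
Lemma exec_compare x zp zf v l t a :
  exists2 b : bool, b <-> reads (zp, zf) x &
  exec compare (mk (zp, zf) v (0%Z, fill 0 (bits x)) l t (cell a))
    (mk (zp, zf) v (0%Z, fill 0 (bits x)) l t (cell (bit b))).
Proof.
have [//|k [le ex eqv]] := @exec_match_loop x [::] zp zf v l t (cell a).
exists ((k == size x) && ~~ isbit (zf (zp + Z.of_nat k)%Z)).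
  rewrite -eqv; split; first by case/andP => /eqP ? /negbTE.
  by case=> /eqP -> ->.
apply: ExecSeq; first by move: ex; rewrite Z.add_0_r; apply.
rewrite /cell; straight; rewrite upd_cell.
have -> : isbit (fill 0 (bits ([::] ++ x)) (Z.of_nat k)) = (k < size x).
  by rewrite -[Z.of_nat k]Z.add_0_l isbit_fill_bits.
rewrite -leqNgt eqn_leq [k <= _]le /=.
apply: ExecSeq; first exact: exec_rewind_XZ le.
straight.
by have -> : (zp - 1 + 1 = zp)%Z; [lia | apply: exec_skip].
Qed.

Lemma reads_embz z x : reads (embz z) x <-> reads z x.
Proof.
rewrite /reads /=; have -> a : isbit (emb a) = isbit a by case: a => [[]|].
split=> -[h ->]; split=> // i /h; last by move->.
by case: (z.2 _) => [[b|]|] //= [->].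
Qed.

(** The input may start at any cell [zp], because the run of [U] does not depend on it; [p] and the
    candidates need not be brought back to the origin. *)
Definition zinit (zp : Z) (r : bitstring) : zconfig U :=
  (start U, fun j => if j == ord0 then (zp, fill zp (bit_syms (aux U) r))
                     else (0%Z, fill 0 [::])).

Lemma crep_zinit zp r : crep (init U r) (zinit zp r).
Proof. by split=> // j; rewrite ffunE /zinit /=; case: ifP => _; apply: rep_tape_of. Qed.

Lemma mku_zinit zp r x l t q :
  mku (zinit zp r).2 x l t q = mk (zp, fill zp (bits r)) (fun _ => blank) x l t q.
Proof.
rewrite /mku /embz /= fill_map // /bit_syms -map_comp /=.
apply: mk_congr => j /negbTE ne /=; rewrite ne /embz /= fill_map //.
Qed.

Lemma zinit_reads zp r k x :
  reads ((iter k (@zstep U) (zinit zp r)).2 ord0) x <->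
  output (iter k (@step U) (init U r)) = x.
Proof.
case: (crep_iter k (crep_zinit zp r)) => _ /(_ ord0) h.
exact: iff_sym (rep_reads x h).
Qed.

Lemma zinit_state zp r k :
  (iter k (@zstep U) (zinit zp r)).1 = (iter k (@step U) (init U r)).1.
Proof. by case: (crep_iter k (crep_zinit zp r)). Qed.

Definition halts_by (r : bitstring) (k : nat) : bool :=
  halting (iter k (@step U) (init U r)).1.

Lemma halted_iter r k n : halts_by r k -> k <= n ->
  iter n (@step U) (init U r) = iter k (@step U) (init U r).
Proof.
move=> h le; rewrite -(subnK le) iterD; elim: (n - k) => //= i ->.
by rewrite /step -/(halts_by r k) h.
Qed.

Lemma stopping_time r t :
  exists k, [/\ k <= t, forall i, i < k -> ~~ halts_by r i & halts_by r k || (k == t)].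
Proof.
elim: t => [|t [k [le nh /orP[h|/eqP e]]]]; first by exists 0; rewrite eqxx orbT.
  by exists k; rewrite h ltnW.
case h: (halts_by r k); first by exists k; rewrite h ltnW.
exists t.+1; rewrite eqxx orbT; split=> // i; rewrite ltnS -e leq_eqVlt.
by case/predU1P => [->|/nh //]; rewrite h.
Qed.

Definition accepts (t : nat) (x r : bitstring) : bool :=
  halts_by r t && (output (iter t (@step U) (init U r)) == x).

Definition is_halted (v : I -> sym) : bool :=
  if v Qi is Some (inr (inr (inl s))) then halting s else false.

Definition trial : com I alphabet :=
  Wr Qi (fun _ => state_sym (start U)) ;; run_clocked ;;
  If is_halted compare (Wr Qi (fun _ => bit false) ;; Skip) ;; undo.

Lemma exec_trial r x t zp l a (st := fun b => mk (zp, fill zp (bits r)) (fun _ => blank)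
    (0%Z, fill 0 (bits x)) l (0%Z, fill 0 (nseq t mark)) (cell b)) :
  exec trial (st a) (st (bit (accepts t x r))).
Proof.
have [k [le nh stop]] := stopping_time r t.
rewrite {}/st -!mku_zinit /trial {1}/mku /cell; straight; rewrite upd_cell -/(mku _).
pose c0 := zinit zp r.
have nhz : forall i, i < k -> ~~ halting (iter i (@zstep U) c0).1.
  by move=> i; rewrite zinit_state; exact: nh.
have stopz : halting (iter (0 + k) (@zstep U) c0).1 || (0 + k == t).
  by rewrite zinit_state.
apply: ExecSeq.
  have := exec_run_clocked (0%Z, fill 0 (bits x)) l (le : 0 + k <= t) nhz stopz.
  by rewrite {1}/run_store {1}/clock subn0; apply.
apply: ExecSeq; last exact: (exec_undo _ _ _ le nhz).
apply: ExecIf.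
have -> : is_halted (view (run_store c0 (0%Z, fill 0 (bits x)) l k t
    (cell (state_sym (iter k (@zstep U) c0).1)))) = halts_by r k.
  by rewrite /halts_by -(zinit_state zp).
case: ifP stop => [h _|h /eqP e]; last first.
  rewrite /run_store /mku /cell; straight; rewrite upd_cell.
  by rewrite /accepts -e h; apply: exec_skip.
have [b eqv ex] := exec_compare x (embz ((iter k (@zstep U) c0).2 ord0)).1
   (embz ((iter k (@zstep U) c0).2 ord0)).2 (embz \o (iter k (@zstep U) c0).2) l
   (Z.of_nat k, fill 0 (clock c0 k t)) (state_sym (iter k (@zstep U) c0).1).
suff -> : accepts t x r = b by apply: ex.
rewrite /accepts {1}/halts_by (halted_iter h le) -/(halts_by r k) h.
apply/eqP/idP => [|].
  by move/(zinit_reads zp)/reads_embz => hr; apply/eqv.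
by move/eqv/reads_embz/zinit_reads.
Qed.

(** * Searching for a shortest program *)

(** The head on [Li] follows the carry: it ends on a mark exactly if the next digit still lies
    within the length bound. *)
Definition carry : com I alphabet :=
  While (fun v => is_bit_of true (v Zi))
    (Wr Zi (fun _ => bit false) ;; Mv Zi MoveRight ;; Mv Li MoveRight).

Lemma exec_carry k r a zp v x lf t q :
  head false r = false ->
  exec carry
    (mk ((zp + Z.of_nat (size a))%Z, fill zp (bits (a ++ nseq k true ++ r))) v x
        (Z.of_nat (size a), lf) t q)
    (mk ((zp + Z.of_nat (size a + k))%Z, fill zp (bits (a ++ nseq k false ++ r))) v x
        (Z.of_nat (size a + k), lf) t q).
Proof.
move=> hr; elim: k a => [|k IH] a.
  rewrite addn0; apply: ExecDone; rewrite viewE fill_nth.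
  rewrite /bit_syms map_cat nth_cat size_map ltnn subnn /=.
  by case: r hr => //= b r ->.
have sa : size a = size (bits a) by rewrite size_map.
apply: exec_loop.
  by rewrite viewE sa /bit_syms map_cat fill_cat.
straight; rewrite [X in upd _ (zp + Z.of_nat X)%Z]sa /bit_syms map_cat upd_fill_cat.
rewrite -cat_rcons -map_rcons -map_cat.
have := IH (rcons a false); rewrite size_rcons addSnnS !cat_rcons.
have -> : (zp + Z.of_nat (size a).+1 = zp + Z.of_nat (size a) + 1)%Z by lia.
by have -> : (Z.of_nat (size a).+1 = Z.of_nat (size a) + 1)%Z by lia.
Qed.

Definition rewind_LZ : com I alphabet :=
  While (fun v => isbit (v Li)) (Mv Li MoveLeft ;; Mv Zi MoveLeft).

Lemma exec_rewind_LZ k r zp zf v x t q :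
  k <= size r ->
  exec rewind_LZ
    (mk ((zp + Z.of_nat k - 1)%Z, zf) v x ((Z.of_nat k - 1)%Z, fill 0 (bits r)) t q)
    (mk ((zp - 1)%Z, zf) v x ((-1)%Z, fill 0 (bits r)) t q).
Proof.
elim: k => [|k IH] le.
  by rewrite Z.add_0_r; apply: ExecDone; rewrite viewE fill_lt.
have -> : (Z.of_nat k.+1 - 1 = 0 + Z.of_nat k)%Z by lia.
apply: exec_loop; first by rewrite viewE isbit_fill_bits.
straight.
have -> : (0 + Z.of_nat k + -1 = Z.of_nat k - 1)%Z by lia.
have -> : (zp + Z.of_nat k.+1 - 1 + -1 = zp + Z.of_nat k - 1)%Z by lia.
exact/IH/ltnW.
Qed.

(** After the carry the head scans either a [false], which has to become [true], or a blank, which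
    has to become a new digit [false]; [bit (isbit _)] covers both. A blank on [Qi] signals that the
    candidates are exhausted. *)
Definition next : com I alphabet :=
  carry ;;
  If (fun v => isbit (v Li))
    (Wr Zi (fun v => bit (isbit (v Zi))) ;; Mv Li MoveLeft ;; Mv Zi MoveLeft ;; rewind_LZ ;;
     Mv Li MoveRight ;; Mv Zi MoveRight ;; Skip)
    (Wr Qi (fun _ => None) ;; Skip).

Notation marks M := (fill 0 (bits (nseq M true))).

Lemma isbit_marks M k : isbit (marks M (Z.of_nat k)) = (k < M).
Proof. by rewrite -[Z.of_nat k]Z.add_0_l isbit_fill_bits size_nseq. Qed.

Lemma exec_next M r zp v x t q :
  size (inc r) <= M ->
  exec next (mk (zp, fill zp (bits r)) v x (0%Z, marks M) t q)
    (mk (zp, fill zp (bits (inc r))) v x (0%Z, marks M) t q).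
Proof.
have [k [r' [-> hr' ->]]] := inc_carry r; rewrite size_cat size_nseq => le.
have kM : k < M by move: le; case: r' hr' => /= *; lia.
apply: ExecSeq.
  have := @exec_carry k r' [::] zp v x (marks M) t q hr'.
  by rewrite /= Z.add_0_r add0n; apply.
apply: ExecIf; rewrite viewE isbit_marks kM; straight.
have sk : k = size (bits (nseq k false)) by rewrite size_map size_nseq.
have -> : upd (fill zp (bits (nseq k false ++ r'))) (zp + Z.of_nat k)
    (bit (isbit (fill zp (bits (nseq k false ++ r')) (zp + Z.of_nat k))))
  = fill zp (bits (nseq k false ++ (if r' is _ :: r'' then true :: r'' else [:: false]))).
  rewrite isbit_fill_bits size_cat size_nseq {2}sk /bit_syms !map_cat.
  case: r' {hr' le} => [|b r'] /=.
    by rewrite addn0 ltnn cats0 upd_fill_size cats1.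
  by rewrite upd_fill_cat (_ : k < k + (size r').+1) //; lia.
apply: ExecSeq; first by apply: (@exec_rewind_LZ k); rewrite size_nseq ltnW.
straight.
by have -> : (zp - 1 + 1 = zp)%Z; [lia | apply: exec_skip].
Qed.

Lemma exec_next_overflow M zp v x t a :
  exec next (mk (zp, fill zp (bits (nseq M true))) v x (0%Z, marks M) t (cell a))
    (mk ((zp + Z.of_nat M)%Z, fill zp (bits (nseq M false))) v x
        (Z.of_nat M, marks M) t (cell None)).
Proof.
apply: ExecSeq.
  have := @exec_carry M [::] [::] zp v x (marks M) t (cell a) erefl.
  by rewrite /= Z.add_0_r add0n !cats0; apply.
apply: ExecIf; rewrite viewE isbit_marks ltnn /cell; straight.
by rewrite upd_cell; apply: exec_skip.
Qed.

Definition search : com I alphabet :=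
  While (fun v => is_bit_of false (v Qi))
    (trial ;; If (fun v => is_bit_of false (v Qi)) next (Skip)).

Section Search.
Variables (M t : nat) (x : bitstring) (zp : Z).

Definition search_store (r : bitstring) (a : sym) :=
  mk (zp, fill zp (bits r)) (fun _ => blank) (0%Z, fill 0 (bits x)) (0%Z, marks M)
     (0%Z, fill 0 (nseq t mark)) (cell a).

Definition overflow_store :=
  mk ((zp + Z.of_nat M)%Z, fill zp (bits (nseq M false))) (fun _ => blank)
     (0%Z, fill 0 (bits x)) (Z.of_nat M, marks M) (0%Z, fill 0 (nseq t mark)) (cell None).

(** Induction on the number of candidates left. Only the verdict [false] keeps the loop going; it
    ends with [true] on success and with a blank on overflow. *)
Lemma exec_search n : n <= rank (nseq M true) ->
  (exists k, [/\ k <= rank (nseq M true),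
                 exec search (search_store (nth_string n) (bit false))
                   (search_store (nth_string k) (bit true)),
                 accepts t x (nth_string k) &
                 forall i, n <= i < k -> ~~ accepts t x (nth_string i)]) \/
  (exec search (search_store (nth_string n) (bit false)) overflow_store /\
   forall i, n <= i <= rank (nseq M true) -> ~~ accepts t x (nth_string i)).
Proof.
move En : (rank (nseq M true) - n) => d; elim: d n En => [|d IH] n En le.
all: have ex1 := exec_trial (nth_string n) x t zp (0%Z, marks M) (bit false).
all: case E: (accepts t x (nth_string n)) ex1 => ex1.
1,3: left; exists n; split=> // [|i]; last by lia.
1,2: by apply: ExecLoop; [ | apply: ExecSeq ex1 _; apply: ExecIf; apply: exec_skip
                           | apply: ExecDone].
- have nE : n = rank (nseq M true) by lia.
  right; split=> [|i hi]; last by rewrite (_ : i = n) ?E; lia.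
  apply: ExecLoop; [by [] | | exact: ExecDone].
  apply: ExecSeq ex1 _; apply: ExecIf.
  by rewrite nE nth_string_rank; apply: exec_next_overflow.
- have ex2 : forall s', exec search (search_store (nth_string n.+1) (bit false)) s' ->
      exec search (search_store (nth_string n) (bit false)) s'.
    move=> s'; apply: ExecLoop => //; apply: ExecSeq ex1 _; apply: ExecIf.
    by apply: exec_next; apply: (@size_nth_string_max M n.+1); lia.
  have [||[k [le' ex acc nacc]]|[ex nacc]] := IH n.+1; try lia.
    left; exists k; split=> // [|i hi]; first exact: ex2.
    by case: (eqVneq i n) => [->|ne]; [rewrite E | apply: nacc; lia].
  right; split=> [|i hi]; first exact: ex2.
  by case: (eqVneq i n) => [->|ne]; [rewrite E | apply: nacc; lia].
Qed.

End Search.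

(** * The compressing machine *)

Definition erase_Z : com I alphabet :=
  While (fun v => isbit (v Zi)) (Wr Zi (fun _ => None) ;; Mv Zi MoveRight).

Lemma exec_erase_Z p zp v x l t q :
  exec erase_Z (mk (zp, fill zp (bits p)) v x l t q)
    (mk ((zp + Z.of_nat (size p))%Z, fill (zp + Z.of_nat (size p)) [::]) v x l t q).
Proof.
elim: p zp => [|b p IH] zp.
  by rewrite Z.add_0_r; apply: ExecDone; rewrite viewE -[X in fill _ _ X]Z.add_0_r (fill_nth _ _ 0).
apply: exec_loop; first by rewrite viewE fill_head.
straight; rewrite upd_fill_head /=.
by have -> : (zp + Z.of_nat (size p).+1 = zp + 1 + Z.of_nat (size p))%Z by lia.
Qed.

(** Erasing [p] leaves the empty string, which is the first candidate, and the [false] on [Qi] opens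
    the search loop. *)
Definition timing : com I alphabet :=
  Wr Qi (fun _ => state_sym (start U)) ;; run_free ;; undo ;; erase_Z ;;
  Wr Qi (fun _ => bit false) ;; Skip.

Lemma exec_timing p t zp x l :
  (forall i, i < t -> ~~ halts_by p i) -> halts_by p t ->
  exists zp', exec timing (mk (zp, fill zp (bits p)) (fun _ => blank) x l blank blank)
    (mk (zp', fill zp' [::]) (fun _ => blank) x l (0%Z, fill 0 (nseq t mark))
        (cell (bit false))).
Proof.
move=> nh h; pose c0 := zinit zp p; exists (zp + Z.of_nat (size p))%Z.
have nhz : forall i, i < 0 + t -> ~~ halting (iter i (@zstep U) c0).1.
  by move=> i; rewrite zinit_state; exact: nh.
have hz : halting (iter (0 + t) (@zstep U) c0).1 by rewrite zinit_state.
rewrite -mku_zinit /timing {1}/mku /blank; straight.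
rewrite (upd_fill_size 0 [::]) -/(mku _).
apply: ExecSeq; first exact: (exec_run_free x l nhz hz).
apply: ExecSeq; first exact: (exec_undo _ _ _ (leqnn _) nhz).
rewrite mku_zinit; apply: ExecSeq; first exact: exec_erase_Z.
by rewrite /cell; straight; rewrite upd_cell; apply: exec_skip.
Qed.

Definition copy_XZ : com I alphabet :=
  While (fun v => isbit (v Xi))
    (Wr Zi (fun v => v Xi) ;; Mv Zi MoveRight ;; Mv Xi MoveRight).

Lemma exec_copy_XZ r p y zp v l t q :
  exec copy_XZ
    (mk ((zp + Z.of_nat (size (p ++ y)))%Z, fill zp (bits (p ++ y))) v
        (Z.of_nat (size y), fill 0 (bits (y ++ r))) l t q)
    (mk ((zp + Z.of_nat (size (p ++ y ++ r)))%Z, fill zp (bits (p ++ y ++ r))) v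
        (Z.of_nat (size (y ++ r)), fill 0 (bits (y ++ r))) l t q).
Proof.
elim: r y => [|b r IH] y.
  rewrite !cats0; apply: ExecDone.
  by rewrite viewE -[X in fill _ _ X]Z.add_0_l isbit_fill_bits ltnn.
have Xr : fill 0 (bits (y ++ b :: r)) (Z.of_nat (size y)) = bit b.
  by rewrite -[X in fill _ _ X]Z.add_0_l /bit_syms map_cat -(size_map (fun b => bit b)) fill_cat.
apply: exec_loop; first by rewrite viewE Xr.
straight; rewrite Xr.
have := upd_fill_size zp (bits (p ++ y)) (bit b); rewrite size_map -map_rcons => ->.
have := IH (rcons y b); rewrite cat_rcons rcons_cat !size_cat size_rcons.
have -> : (Z.of_nat (size y).+1 = Z.of_nat (size y) + 1)%Z by lia.
have -> : (zp + Z.of_nat (size p + (size y).+1) = zp + Z.of_nat (size p + size y) + 1)%Z by lia.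
by [].
Qed.

(** Bits are written leftwards, hence the [rev] in [finish]. *)
Fixpoint prepend (l : bitstring) : com I alphabet :=
  if l is b :: l' then Mv Zi MoveLeft ;; Wr Zi (fun _ => bit b) ;; prepend l' else Skip.

Lemma exec_prepend r y zp zf v x l t q :
  reads (zp, zf) y ->
  exists zp' zf', exec (prepend r) (mk (zp, zf) v x l t q) (mk (zp', zf') v x l t q) /\
    reads (zp', zf') (catrev r y).
Proof.
elim: r y zp zf => [|b r IH] y zp zf hy /=.
  by exists zp, zf; split=> //; apply: exec_skip.
have {}/IH[zp' [zf' [ex hr]]] : reads ((zp + -1)%Z, upd zf (zp + -1) (bit b)) (b :: y).
  case: hy => /= hy1 hy2; split=> [[|i] lt|] /=.
  - by rewrite Z.add_0_r upd_eq.
  - by rewrite upd_neq; [rewrite -hy1 //; congr zf | ]; lia.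
  - by rewrite upd_neq; [rewrite -hy2 //; congr (isbit (zf _)) | ]; lia.
by exists zp', zf'; split=> //; straight.
Qed.

Definition finish (pref : bitstring) : com I alphabet :=
  If (fun v => isbit (v Qi)) (Skip)
    (copy_XZ ;; Mv Xi MoveLeft ;; Mv Zi MoveLeft ;; rewind_XZ ;; Mv Zi MoveRight ;;
     prepend (rev pref)).

Lemma reads_fill s p y : reads (s + Z.of_nat (size p), fill s (bits (p ++ y)))%Z y.
Proof.
split=> [i lt|] /=; rewrite -Z.add_assoc -Nat2Z.inj_add.
  rewrite fill_nth (nth_map false) ?size_cat ?ltn_add2l //.
  by rewrite nth_cat ltnNge leq_addr /= addKn.
by rewrite isbit_fill_bits size_cat ltnn.
Qed.

Definition program (pref : bitstring) : com I alphabet :=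
  setup ;; timing ;; search ;; finish pref.

(** The bound on [size y] in the first alternative serves the strings with C(x) > m, for which a
    program longer than m may be found. *)
Lemma computes_program pref j p x t (d := nseq j false ++ true :: p) :
  (forall i, i < t -> ~~ halts_by p i) -> halts_by p t ->
  exists y, computes (compile (program pref)) (pair_str d x) y /\
    ([/\ size y <= size d, accepts t x y & forall r, accepts t x r -> size y <= size r] \/
     (y = pref ++ x /\ forall r, size r <= size d -> ~~ accepts t x r)).
Proof.
move=> nh h.
have [zp ex1] := exec_setup j p x.
have [zp' ex2] := exec_timing zp (0%Z, fill 0 (bits x)) (0%Z, marks (size d)) nh h.
have inputE : @input_store w 4 alphabet (pair_str d x) =
    mk (0%Z, fill 0 (bits (pair_str d x))) (fun _ => blank) blank blank blank blank.
  apply: functional_extensionality => -[j0|[[|[|[|[|k]]]] hk]] //=.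
  by rewrite /input_store; case: (j0 =P ord0) => [->|/eqP/negbTE ne]; rewrite ?eqxx // /eq_op /= ne.
have [//|[k [le ex3 acc nacc]]|[ex3 nacc]] := @exec_search (size d) t x zp' 0.
- exists (nth_string k); split; last first.
    left; split=> // [|r accr]; first exact: size_nth_string_max.
    (* A string shorter than the one found has smaller rank, hence was rejected before. *)
    rewrite leqNgt; apply/negP => lt.
    have := nacc (rank r); rewrite nth_string_rank accr /= => /(_ _)/negP; apply=> //.
    by rewrite ltnNge; apply/negP => /size_nth_string; rewrite nth_string_rank; lia.
  apply: exec_computes.
    rewrite inputE; apply: ExecSeq ex1 _; apply: ExecSeq ex2 _; apply: ExecSeq ex3 _.
    by apply: ExecIf; apply: exec_skip.
  by have := reads_fill zp' [::] (nth_string k); rewrite Z.add_0_r.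
- exists (pref ++ x); split; last first.
    by right; split=> // r /rank_max le; have := nacc (rank r) le; rewrite nth_string_rank.
  set M := size d in ex3 *.
  (* The M digits [false] left behind by the overflow lie to the left of the head and are not part
     of what is read. *)
  have rd : reads ((zp' + Z.of_nat M)%Z, fill zp' (bits (nseq M false ++ x))) x.
    by have := reads_fill zp' (nseq M false) x; rewrite size_nseq.
  have [zp2 [zf2 [ex4 hr]]] := exec_prepend (rev pref) (fun _ => blank)
    ((-1)%Z, fill 0 (bits x)) (Z.of_nat M, marks M) (0%Z, fill 0 (nseq t mark)) (cell None) rd.
  pose fin := mk (zp2, zf2) (fun _ => blank) ((-1)%Z, fill 0 (bits x))
    (Z.of_nat M, marks M) (0%Z, fill 0 (nseq t mark)) (cell None).
  apply: (@exec_computes _ _ _ _ _ fin); last by move: hr; rewrite catrevE revK.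
  rewrite inputE; apply: ExecSeq ex1 _; apply: ExecSeq ex2 _; apply: ExecSeq ex3 _.
  apply: ExecIf; rewrite /overflow_store /=.
  apply: ExecSeq.
    by have := exec_copy_XZ x (nseq M false) [::] zp'; rewrite cats0 size_nseq; apply.
  straight; apply: ExecSeq.
    have := @exec_rewind_XZ (size x) x (zp' + Z.of_nat M)%Z.
    rewrite size_cat size_nseq Nat2Z.inj_add Z.add_assoc; apply; exact: leqnn.
  straight.
  have -> : (zp' + Z.of_nat M - 1 + 1 = zp' + Z.of_nat M)%Z by lia.
  exact: ex4.
Qed.

End Program.

(** * The slowest program, and the choice of the constants *)

Lemma halts_by_leq (U : machine) r k n : halts_by U r k -> k <= n -> halts_by U r n.
Proof. by move=> h le; rewrite /halts_by (halted_iter h le). Qed.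

(** A maximum of finitely many halting times. Which programs halt is settled by excluded middle, so
    [p] and [t] exist without being computed. *)
Lemma slowest_program (U : machine) m :
  (exists r n, size r <= m /\ halts_by U r n) ->
  exists p t, [/\ size p <= m, forall i, i < t -> ~~ halts_by U p i, halts_by U p t &
    forall r n, size r <= m -> halts_by U r n -> halts_by U r t].
Proof.
(* An initial segment of the enumeration may contain no halting program; the first alternative
   carries the induction until one appears. *)
have slowest N : (forall i n, i < N -> ~~ halts_by U (nth_string i) n) \/
    exists j t, [/\ j < N, forall i, i < t -> ~~ halts_by U (nth_string j) i,
      halts_by U (nth_string j) t &
      forall i n, i < N -> halts_by U (nth_string i) n -> halts_by U (nth_string i) t].
  elim: N => [|N IH]; first by left.
  have [hN|nhN] := classic (exists n, halts_by U (nth_string N) n); last first.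
    have nh n : ~~ halts_by U (nth_string N) n by apply/negP => h; apply: nhN; exists n.
    case: IH => [IH|[j [t [lt nht ht IH]]]].
      left=> i n; rewrite ltnS leq_eqVlt => /predU1P[->|/IH //]; exact: nh.
    right; exists j, t; split=> //; first exact: ltnW.
    move=> i n; rewrite ltnS leq_eqVlt => /predU1P[->|/IH]; last exact.
    by rewrite (negbTE (nh n)).
  case: (ex_minnP hN) => t' ht' min.
  have nht' i : i < t' -> ~~ halts_by U (nth_string N) i.
    by move=> lt; apply/negP => /min; rewrite leqNgt lt.
  right; case: IH => [IH|[j [t [lt nht ht IH]]]].
    exists N, t'; split=> // i n; rewrite ltnS leq_eqVlt => /predU1P[->|lt] //.
    by rewrite (negbTE (IH _ n lt)).
  case: (leqP t t') => le.
    exists N, t'; split=> // i n; rewrite ltnS leq_eqVlt => /predU1P[->|/IH h] //.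
    by move/h/halts_by_leq; apply.
  exists j, t; split=> //; first exact: ltnW.
  move=> i n; rewrite ltnS leq_eqVlt => /predU1P[->|/IH h]; last exact: h.
  by move=> _; apply: halts_by_leq ht' (ltnW le).
move=> [r [n [sr hr]]].
have lt s : size s <= m -> rank s < (rank (nseq m true)).+1 by rewrite ltnS; apply: rank_max.
have [nh|[j [t [ltj nht ht max]]]] := slowest (rank (nseq m true)).+1.
  by have := nh _ n (lt _ sr); rewrite nth_string_rank hr.
exists (nth_string j), t; split=> //; first exact: size_nth_string_max.
by move=> s k /lt/max; rewrite nth_string_rank; apply.
Qed.

Lemma accepts_computes (U : machine) t x r : accepts U t x r -> computes U r x.
Proof. by case/andP=> h /eqP e; exists t. Qed.

Lemma computes_accepts (U : machine) t x r :
  computes U r x -> halts_by U r t -> accepts U t x r.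
Proof.
move=> hx h; rewrite /accepts h; apply/eqP.
by apply: computes_unique hx; exists t.
Qed.

Theorem theorem1 (U : machine) (hU : universal U) (hd : hardwires_data U) :
  exists k : nat, forall m : nat, exists q : bitstring,
    compression_function U q /\ size q <= m + k /\
    forall x : bitstring, exists y : bitstring,
      computes U (pair_str q x) y /\
      (C U x <= m -> size y = C U x) /\
      (m < C U x -> size y <= size x + k).
Proof.
have [pid Uid] := hU id_machine.
(* [pref ++ x] is [pair_str pid x]: the literal description of x. *)
pose pref := nseq (size pid) true ++ false :: pid.
have Upref x : computes U (pref ++ x) x.
  by rewrite /pref -catA; apply/Uid/computes_id.
pose m0 := size pref.
have [pM UM] := hU (compile (program U pref)).
have [c hw] := hd pM.
(* As |d| = m + m0 + 1, the length of q is at most m + m0 + 1 + c. If C(x) > m, then m < |x| + m0,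
   so a program found among the strings of length at most |d| has length at most |x| + 2 m0. *)
exists (m0 + m0 + c + 1) => m.
(* The length bound is raised by m0 so that some program halts: [pref] itself, which prints the
   empty string. *)
have [|p [t [sp nht ht max]]] := @slowest_program U (m + m0).
  have [n [h _]] := Upref [::]; exists (pref ++ [::]), n.
  by rewrite cats0 leq_addl; split=> //; move: h; rewrite cats0.
pose d := nseq (m + m0 - size p) false ++ true :: p.
have sd : size d = (m + m0).+1 by rewrite size_cat size_nseq /=; lia.
have [q [sq Uq]] := hw d; exists q.
have main x : exists y, [/\ computes U (pair_str q x) y, computes U y x,
    C U x <= m -> size y = C U x & m < C U x -> size y <= size x + (m0 + m0 + c + 1)].
  have [y [My alt]] := computes_program pref (m + m0 - size p) x nht ht.
  have [[r [Ur sr]] Cmin] := CP x hU.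
  have Cx : C U x <= m0 + size x by rewrite -size_cat; apply: Cmin.
  exists y; split; first exact/Uq/UM.
  - by case: alt => [[_ /accepts_computes]|[->]].
  (* A shortest program for x halts, hence within t steps, and is accepted. The output is then a
     program for x no longer than it, so it is shortest as well. *)
  - move=> le; have acc : accepts U t x r.
      case: (Ur) => n [hn _]; apply: computes_accepts => //; apply: max hn.
      by rewrite sr; lia.
    case: alt => [[_ /accepts_computes Uy /(_ r acc)]|[_ /(_ r)]].
      by rewrite sr => le'; apply/eqP; rewrite eqn_leq le' Cmin.
    (* The literal description is returned only if no string of length at most |d| is accepted, but
       [r] is. *)
    by rewrite acc -/d sd sr => /(_ _)/negP; case=> //; lia.
  - move=> lt; case: alt => [[sy _ _]|[-> _]]; last by rewrite size_cat -/m0; lia.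
    by move: sy; rewrite -/d sd; lia.
split=> [n z _|]; first by have [y []] := main z; exists y.
split=> [|x]; first by move: sq; rewrite sd; lia.
by have [y []] := main x; exists y.
Qed.
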